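(* Let $Q$ be a medial quandle with finite orbits and assume that for every orbit $A$ of $Q$ there is an orbit $B$ of $Q$ such that $|A|$ and $|B|$ are coprime. Then $Q$ is $2$-reductive.
   Context: A quandle is a non-empty set $Q$ with a binary operation such that for all $x,y,z$: $xx=x$; $x(yz)=(xy)(xz)$; and $xu=y$ has a unique solution $u\in Q$. It is medial if $(xy)(uv)=(xu)(yv)$ for all $x,y,u,v\in Q$. The left translation by $a$ is $L_a(x)=ax$; $\mathrm{LMlt}(Q)$ is the permutation group generated by all $L_a$, $a\in Q$. The orbits of $Q$ are the orbits of the action of $\mathrm{LMlt}(Q)$ on $Q$. A binary algebra is $2$-reductive if $(xy)y=y$ for all $x,y$. *)

(* Defs.v *)
From mathcomp Require Export all_boot.
From mathcomp Require Export boolp classical_sets functions cardinality.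

Set Implicit Arguments.
Unset Strict Implicit.
Unset Printing Implicit Defensive.

Local Open Scope classical_set_scope.

Section Quandles.
Context {Q : Type}.
Implicit Types (op : Q -> Q -> Q) (f g : Q -> Q) (G : set (Q -> Q)).

Record is_quandle op : Prop := IsQuandle {
  quandle_nonempty : [set: Q] !=set0;
  quandle_idem : idempotent_op op;
  quandle_distr : right_distributive op op;
  quandle_solv : forall x y, exists! u, op x u = y
}.

Definition medial op : Prop :=
  forall x y u v, op (op x y) (op u v) = op (op x u) (op y v).

Definition two_reductive op : Prop := forall x y, op (op x y) y = y.

Definition left_translation op (a : Q) : Q -> Q := fun x => op a x.

Record perm_group G : Prop := PermGroup {
  perm_group_bij : forall f, G f -> bijective f;
  perm_group_id : G id;
  perm_group_comp : forall f g, G f -> G g -> G (f \o g);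
  perm_group_inv : forall f g, G f -> cancel f g -> cancel g f -> G g
}.

(* The intersection of all permutation groups on Q containing the left
   translations; in a quandle these are bijective, so there is at least one
   such group and LMlt op is itself a permutation group. *)
Definition LMlt op : set (Q -> Q) :=
  smallest perm_group (range (left_translation op)).

Definition orbit_of op (x : Q) : set Q := [set f x | f in LMlt op].

Definition orbits op : set (set Q) := range (orbit_of op).

(* Stated relationally because Q is an arbitrary type: the numbers m and n are
   unique, and they exist as soon as A and B are finite. *)
Definition coprime_card (A B : set Q) : Prop :=
  exists m n : nat, [/\ (A #= `I_m)%card, (B #= `I_n)%card & coprime m n].

End Quandles.

(* Main.v *)
Require Import Defs.

Set Implicit Arguments.
Unset Strict Implicit.
Unset Printing Implicit Defensive.

Local Open Scope classical_set_scope.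

(** Write [L_a] for the left translation by [a].  Mediality says exactly that
    the displacements [L_a L_b^-1] commute with each other
    ([displacement_comm]).  They act transitively on each orbit, because
    [L_c z = L_c L_z^-1 z], so a power of a displacement that fixes one point
    of an orbit fixes all of it.  On an orbit of size [m] all cycles of a
    displacement therefore have the same length, which divides [m], and its
    [m]-th power is the identity there ([iter_displacement_card]).

    Let the orbits of [f] and [y] have coprime sizes [m] and [n], and put
    [alpha = L_x L_f^-1] and [delta = L_(xf) L_f^-1].  On the orbit of [y] the
    [n]-th power of [delta] is the identity.  But [alpha] is an automorphism
    with [alpha f = xf] that commutes with [delta], so the translation by
    [alpha^k f] is [delta^k L_f]; since [alpha^m f = f], the [m]-th power of
    [delta] is the identity as well.  Hence [delta] is the identity on the
    orbit of [y], i.e. [(xf)u = fu] for all [x] and all [u] in that orbit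
    ([coprime_orbits_translation]).

    Writing [y = fu], mediality gives [(xy)y = (xy)(fu) = (xf)(yu) = f(yu)].
    The right-hand side does not depend on [x], and for [x = y] the left-hand
    side is [y]. *)

Section Iterates.
Context {T : Type}.
Implicit Types (f : T -> T) (x : T).

Lemma iter_fixedM f x m k : iter m f x = x -> iter (k * m) f x = x.
Proof. by move=> fx; elim: k => // k IHk; rewrite mulSn iterD IHk. Qed.

Lemma iter_fixed_coprime f x m n : coprime m n ->
  iter m f x = x -> iter n f x = x -> f x = x.
Proof.
move=> cop fm fn; have [m0|m_gt0] := posnP m.
  by move: cop fn; rewrite m0 /coprime gcd0n => /eqP->.
have [a _] := Bezoutl n m_gt0; rewrite (eqP cop) => /dvdnP[k def_k].
by rewrite -[LHS]/(iter 1 f x) -{1}(iter_fixedM a fn) -iterD def_k iter_fixedM.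
Qed.

End Iterates.

(** If a power of [h] fixing one point fixes every point, then all cycles of [h]
    have the same length, and that length times the number of cycles is the
    number of points. *)
Lemma iter_card_semiregular (T : finType) (h : T -> T) : injective h ->
  (forall k x y, iter k h x = x -> iter k h y = y) ->
  forall x, iter #|T| h x = x.
Proof.
move=> inj_h reg x.
have le_order y z : (order h z <= order h y)%N.
  rewrite leqNgt; apply/negP => lt_yz.
  have fix_z := reg _ y z (iter_order inj_h y).
  have := findex_iter lt_yz; rewrite fix_z findex0 => order0.
  by have := order_gt0 h y; rewrite -order0.
have sub_order : predT \subset order_set h (order h x).
  by apply/fintype.subsetP => y _; rewrite inE eqn_leq !le_order.
have <- := fcard_order_set inj_h sub_order (fun y z _ => erefl).
exact/iter_fixedM/iter_order.
Qed.

(** Transport of the previous lemma along a bijection between [A] and [I_m], as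
    the points of [A] are not those of a [finType]. *)
Lemma iter_card_semiregular_on (T : Type) (A : set T) (g : T -> T) (m : nat) :
  (A #= `I_m)%card -> injective g -> (forall x, A x -> A (g x)) ->
  (forall k x y, A x -> A y -> iter k g x = x -> iter k g y = y) ->
  forall x, A x -> iter m g x = x.
Proof.
move=> /card_set_bijP[r [rA inj_r surj_r]] inj_g gA reg.
have [e eP] : {e : 'I_m -> T & forall i, A (e i) /\ r (e i) = i}.
  apply: (choice (P := fun (i : 'I_m) x => A x /\ r x = i)) => i.
  by have [x Ax <-] := surj_r i (ltn_ord i); exists x.
have eA i : A (e i) by have [] := eP i.
have inj_e i j : e i = e j -> i = j.
  by move=> eij; apply: val_inj; rewrite -[LHS](eP i).2 eij (eP j).2.
have surj_e x : A x -> exists i : 'I_m, e i = x.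
  move=> Ax; exists (Ordinal (rA x Ax)); apply: inj_r; rewrite ?inE //.
  by rewrite (eP _).2.
have [h he] : {h : 'I_m -> 'I_m & forall i, e (h i) = g (e i)}.
  by apply: (choice (P := fun i j : 'I_m => e j = g (e i))) => i;
    apply/surj_e/gA/eA.
have iter_he k i : e (iter k h i) = iter k g (e i).
  by elim: k => //= k <-.
have inj_h : injective h.
  by move=> i j hij; apply/inj_e/inj_g; rewrite -!he hij.
have reg_h k i j : iter k h i = i -> iter k h j = j.
  move=> hi; apply/inj_e; rewrite iter_he; apply: (reg k (e i)) => //.
  by rewrite -iter_he hi.
move=> x /surj_e[i <-]; have := iter_card_semiregular inj_h reg_h i.
by rewrite card_ord -iter_he => ->.
Qed.

Section MedialQuandle.
Context {Q : Type} {op : Q -> Q -> Q}.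
Hypotheses (quandle_op : is_quandle op) (medial_op : medial op).

Local Notation "x * y" := (op x y).

Definition ldiv (a y : Q) : Q := sval (cid (quandle_solv quandle_op a y)).

Local Notation "a \ y" := (ldiv a y) (at level 40, left associativity).

Lemma ldivK a : cancel (ldiv a) (op a).
Proof. by move=> y; rewrite /ldiv; case: cid => u []. Qed.

Lemma opK a : cancel (op a) (ldiv a).
Proof. by move=> y; rewrite /ldiv; case: cid => u [_ /=]; apply. Qed.

Lemma op_inj a : injective (op a).
Proof. exact: can_inj (opK a). Qed.

Lemma op_idem x : x * x = x.
Proof. exact: quandle_idem. Qed.

Lemma ldiv_idem x : x \ x = x.
Proof. by rewrite -{2}[x]op_idem opK. Qed.

Lemma ldiv_op a x y : a \ (x * y) = (a \ x) * (a \ y).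
Proof. by apply: (@op_inj a); rewrite (quandle_distr quandle_op) !ldivK. Qed.

Definition displacement (a b z : Q) : Q := a * (b \ z).

Lemma displacementK a b : cancel (displacement a b) (displacement b a).
Proof. by move=> z; rewrite /displacement opK ldivK. Qed.

Lemma displacement_inj a b : injective (displacement a b).
Proof. exact: can_inj (@displacementK a b). Qed.

Lemma displacement_op a b x y :
  displacement a b (x * y) = displacement a b x * displacement a b y.
Proof. by rewrite /displacement ldiv_op (quandle_distr quandle_op). Qed.

(** Conjugating mediality by [x], since the translation by [xy] is the
    conjugate by [L_x] of the translation by [y]. *)
Lemma op_ldiv_op y x u z : y * (x \ (u * z)) = u * (x \ (y * z)).
Proof.
by apply: (@op_inj x); rewrite !(quandle_distr quandle_op x) !ldivK medial_op.
Qed.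

Lemma ldiv_op_ldiv b a d z : b \ (a * (d \ z)) = d \ (a * (b \ z)).
Proof. by apply: (@op_inj b); rewrite ldivK op_ldiv_op ldivK. Qed.

Lemma displacement_comm a b c d z :
  displacement a b (displacement c d z) = displacement c d (displacement a b z).
Proof. by rewrite /displacement op_ldiv_op ldiv_op_ldiv. Qed.

Lemma iter_displacement_comm k a b c d z :
  iter k (displacement a b) (displacement c d z) =
  displacement c d (iter k (displacement a b) z).
Proof. by elim: k => //= k ->; rewrite displacement_comm. Qed.

Lemma LMlt_op a : LMlt op (op a).
Proof. by move=> G [_ transG]; apply: transG; exists a. Qed.

Lemma LMlt_ldiv a : LMlt op (ldiv a).
Proof.
move=> G [permG transG]; apply: (perm_group_inv permG (f := op a)).
- by apply: transG; exists a.
- exact: opK.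
- exact: ldivK.
Qed.

Lemma LMlt_comp f g : LMlt op f -> LMlt op g -> LMlt op (f \o g).
Proof.
move=> Mf Mg G permG.
by apply: (perm_group_comp permG.1); [exact: Mf|exact: Mg].
Qed.

Lemma orbit_of_refl x : orbit_of op x x.
Proof. by exists id => // G [permG _]; exact: perm_group_id. Qed.

Lemma orbit_of_op x a z : orbit_of op x z -> orbit_of op x (a * z).
Proof.
move=> [f Mf <-]; exists (op a \o f) => //.
exact: LMlt_comp (LMlt_op a) Mf.
Qed.

Lemma orbit_of_ldiv x a z : orbit_of op x z -> orbit_of op x (a \ z).
Proof.
move=> [f Mf <-]; exists (ldiv a \o f) => //.
exact: LMlt_comp (LMlt_ldiv a) Mf.
Qed.

(** The permutations that preserve and reflect [S] form a group containing all
    left translations. *)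
Lemma orbit_of_invariant (S : set Q) : (forall a z, S z <-> S (a * z)) ->
  forall x z, orbit_of op x z -> S x <-> S z.
Proof.
move=> invS x _ [f Mf <-].
have [] // : (bijective f /\ forall z, S z <-> S (f z)).
apply: (Mf [set g | bijective g /\ forall z, S z <-> S (g z)]); split.
  split=> /=.
  - by move=> g [].
  - by split; [exists id|].
  - move=> g h [bij_g Sg] [bij_h Sh]; split; first exact: bij_comp.
    by move=> z; rewrite (Sh z) (Sg (h z)).
  - move=> g h [_ Sg] gK hK; split; first by exists g.
    by move=> z; rewrite (Sg (h z)) hK.
by move=> _ [a _ <-]; split; [exists (ldiv a); [exact: opK|exact: ldivK]|exact: invS].
Qed.

(** Within an orbit every left translation moves [z] as a displacement does,
    and displacements commute. *)
Lemma iter_displacement_fixed k a b x z : orbit_of op x z ->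
  iter k (displacement a b) x = x <-> iter k (displacement a b) z = z.
Proof.
apply: (orbit_of_invariant (S := [set t | iter k (displacement a b) t = t])).
move=> c t /=.
have -> : c * t = displacement c t t by rewrite /displacement ldiv_idem.
rewrite iter_displacement_comm; split=> [-> //|].
exact: displacement_inj.
Qed.

Lemma iter_displacement_card a b x m : (orbit_of op x #= `I_m)%card ->
  forall z, orbit_of op x z -> iter m (displacement a b) z = z.
Proof.
move=> cardx; apply: (iter_card_semiregular_on cardx).
- exact: displacement_inj.
- by move=> z xz; apply/orbit_of_op/orbit_of_ldiv.
- by move=> k z t /(iter_displacement_fixed k a b) <-
    /(iter_displacement_fixed k a b) <-.
Qed.

(** The displacement by [xf] and [f] is the commutator of [L_x L_f^-1] with
    [L_f]; the commutator with a fixed element is multiplicative on the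
    abelian group of displacements. *)
Lemma op_iter_displacement k x f z :
  iter k (displacement x f) f * z = iter k (displacement (x * f) f) (f * z).
Proof.
(* With [z = alpha z'], the left-hand side is the image under the automorphism
   [alpha = L_x L_f^-1] of the product with [z'] given by induction. *)
elim: k z => // k IHk z; rewrite -(displacementK f x z) iterS -displacement_op.
rewrite IHk -iter_displacement_comm displacement_op iterSr.
by rewrite /displacement ldiv_idem !opK.
Qed.

Lemma coprime_orbits_translation x f y u :
  coprime_card (orbit_of op y) (orbit_of op f) ->
  orbit_of op y u -> (x * f) * u = f * u.
Proof.
move=> [n [m [card_y card_f cop]]] yu.
rewrite -{1}[u](opK f) -/(displacement (x * f) f (f * u)).
apply: (iter_fixed_coprime cop).
- exact/(iter_displacement_card _ _ card_y)/orbit_of_op.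
- rewrite -op_iter_displacement (iter_displacement_card _ _ card_f) //.
  exact: orbit_of_refl.
Qed.

Lemma coprime_orbit_reductive x f y :
  coprime_card (orbit_of op y) (orbit_of op f) -> (x * y) * y = y.
Proof.
move=> cop; have yfy := orbit_of_ldiv f (orbit_of_refl y).
have const t : (t * y) * y = f * (y * (f \ y)).
  rewrite -{2}[y](ldivK f) medial_op (coprime_orbits_translation _ cop) //.
  exact: orbit_of_op.
by rewrite const -(const y) !op_idem.
Qed.

End MedialQuandle.

Theorem corollary6p10 (Q : Type) (op : Q -> Q -> Q)
  (quandle_op : is_quandle op) (medial_op : medial op)
  (finite_orbits : forall A : set Q, orbits op A -> finite_set A)
  (coprime_orbits : forall A : set Q, orbits op A ->
    exists B : set Q, orbits op B /\ coprime_card A B) :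
  two_reductive op.
Proof.
move=> x y; have [|B [[f _ <-] cop]] := coprime_orbits (orbit_of op y).
  by exists y.
exact: coprime_orbit_reductive cop.
Qed.
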